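(* Let $G$ be a disjoint union of $n\ge 0$ loops of even lengths $\ell_1,\dots,\ell_n\ge4$. Put $c=cv(G)$, i.e. $c=8+\sum_{i=1}^n(\ell_i-8)$ if $n\ge1$ and $c=0$ if $G$ is empty. Let $f$ be the number of 4-loops in $G$. (a) If $\ell_i\ge 8$ for all $i$ then $v(G)=c$. (b) If $c\ge 2$ or $G$ is empty then $v(G)=c$. (c) If $c\le 0$, $f=0$ and $G$ is non-empty, then $v(G)\in\{2,4\}$ and $v(G)\equiv c\pmod 4$. (d) If $c\le 0$ and $f\ge 1$, let $K$ denote $G$ with all its 4-loops removed. If $v(K)\equiv 2\pmod 4$ then $v(G)=2$. Otherwise $v(G)\in\{0,4\}$ and $v(G)\equiv v(K)+4f\pmod 8$.
   Context: Game. A dots and boxes game (position) $G$ consists of a finite set of unclaimed boxes and a finite set of undrawn lines, each undrawn line bordering either exactly one box or exactly two distinct boxes, each box being bordered by at least one and at most four undrawn lines. Two players play. The player to move draws (removes) an undrawn line; every box none of whose bordering lines is still undrawn is then claimed by that player. If the move claims at least one box the same player must move again (if a line remains); otherwise the other player moves. Claiming a box when possible is not compulsory. The game ends when no line remains. Each player maximises (own boxes) minus (opponent's boxes), counting only boxes claimed from $G$ onwards. Value. $v(G)$ is the net score, under optimal play, of the player who is NOT to move in $G$. Equivalently, $v(G)=0$ if $G$ has no undrawn lines, and otherwise $v(G)=\min_m v(G;m)$ over undrawn lines $m$, where, if drawing $m$ claims $k$ boxes and leaves the position $G_m$, then $v(G;m)=v(G_m)-k$ if $k\ge1$ and $v(G;m)=-v(G_m)$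 if $k=0$. Loops. An $n$-loop (loop of length $n\ge4$), denoted $n_\ell$, is the position with boxes $b_1,\dots,b_n$ and lines $e_1,\dots,e_n$, where $e_i$ borders $b_i$ and $b_{i+1}$ (indices mod $n$). *)

(* Defs.v *)
From HB Require Import structures.
From mathcomp Require Import all_boot all_order all_algebra.

Set Implicit Arguments.
Unset Strict Implicit.
Unset Printing Implicit Defensive.

Import Order.TTheory GRing.Theory Num.Theory.

Local Open Scope ring_scope.

Record position := Position {
  box : finType;
  line : finType;
  border : line -> {set box};
  border_card : forall e, (0 < #|border e| <= 2)%N;
  box_degree : forall b, (0 < #|[set e | b \in border e]| <= 4)%N
}.

(* The positions reachable from [G] are represented by the set [S] of the lines
   of [G] that are still undrawn; the boxes still unclaimed are then exactly
   those bordered by a line of [S], since every box of [G] has a line. *)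
Section Value.

Variable G : position.
Implicit Types (S : {set line G}) (m : line G).

Definition claimed S m : {set box G} :=
  [set b in border m | [forall e in S :\ m, b \notin border e]].

(* The value of moving at [m] in [S], given the values [v] of the positions
   with one line fewer. *)
Definition move_value (v : {set line G} -> int) S m : int :=
  let k := #|claimed S m| in
  if k == 0%N then - v (S :\ m) else v (S :\ m) - k%:Z.

(* The idempotent [Num.min] has no neutral element on [int], so the minimum
   over [S] is started from the value of an arbitrary move [m0] of [S]; the
   argument [d] bounds the number of undrawn lines. *)
Fixpoint value_rec (d : nat) S : int :=
  if d is d'.+1 then
    if [pick m in S] is Some m0 then
      \big[Num.min/move_value (value_rec d') S m0]_(m in S)
        move_value (value_rec d') S m
    else 0
  else 0.

Definition value_at S : int := value_rec #|S| S.

Definition value : int := value_at [set: line G].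

Lemma value_at0 : value_at set0 = 0.
Proof. by rewrite /value_at cards0. Qed.

Lemma value_recS d S m0 : m0 \in S -> #|S| = d.+1 ->
  {in S, move_value (value_rec d) S =1 move_value value_at S}.
Proof.
move=> m0S cS m mS; rewrite /move_value /value_at.
by have -> : #|S :\ m| = d by move: (cardsD1 m S); rewrite mS cS => -[].
Qed.

Lemma value_at_le S m : m \in S -> value_at S <= move_value value_at S m.
Proof.
move=> mS; have: (0 < #|S|)%N by apply/card_gt0P; exists m.
case cS: #|S| => [//|d] _; rewrite {1}/value_at cS /=.
case: pickP => [m0 m0S|/(_ m)]; last by rewrite mS.
by rewrite -(value_recS mS cS mS) (bigD1 m) //= ge_min lexx.
Qed.

Lemma value_at_attained S : S != set0 ->
  exists2 m, m \in S & value_at S = move_value value_at S m.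
Proof.
case/set0Pn=> m mS; have: (0 < #|S|)%N by apply/card_gt0P; exists m.
case cS: #|S| => [//|d] _; rewrite {1}/value_at cS /=.
case: pickP => [m0 m0S|/(_ m)]; last by rewrite mS.
pose P x := exists2 m, m \in S & x = move_value value_at S m.
apply: (@big_ind _ P) => [|x y Px Py|m1 m1S].
- by exists m0; rewrite // (value_recS mS cS).
- by rewrite /Order.min; case: ifP.
- by exists m1; rewrite // (value_recS mS cS).
Qed.

End Value.

(* Also well-formed for [n < 4]; the requirement [4 <= n] on the length of a
   loop is left to the statements about loops. *)
Section Loop.

Variable n : nat.

Definition loop_border (e : 'I_n) : {set 'I_n} := [set e; ordS e].

Fact loop_border_card e : (0 < #|loop_border e| <= 2)%N.
Proof. by rewrite cards2; case: (_ != _). Qed.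

Fact loop_box_degree b : (0 < #|[set e | b \in loop_border e]| <= 4)%N.
Proof.
apply/andP; split; first by apply/card_gt0P; exists b; rewrite !inE eqxx.
apply: (@leq_trans #|[set b; ord_pred b]|); last by rewrite cards2; case: (_ != _).
apply/subset_leq_card/subsetP=> e; rewrite !inE => /orP[/eqP->|/eqP->].
  by rewrite eqxx.
by rewrite ordSK eqxx orbT.
Qed.

Definition loop : position := Position loop_border_card loop_box_degree.

End Loop.

Section DisjointUnion.

Variables (I : finType) (G : I -> position).

Definition union_box : finType := {i : I & box (G i)}.
Definition union_line : finType := {i : I & line (G i)}.

Definition union_border (u : union_line) : {set union_box} :=
  [set Tagged (fun i => box (G i)) b | b in border (tagged u)].

Fact union_border_card u : (0 < #|union_border u| <= 2)%N.
Proof. by rewrite card_imset ?border_card //; apply: eq_from_Tagged. Qed.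

Fact union_box_degree b : (0 < #|[set e | b \in union_border e]| <= 4)%N.
Proof.
case: b => i b; rewrite -[existT _ i b]/(Tagged (fun i => box (G i)) b).
suff -> : [set e | Tagged (fun i => box (G i)) b \in union_border e] =
    [set Tagged (fun i => line (G i)) e | e in [set e | b \in border e]].
  by rewrite card_imset ?box_degree //; apply: eq_from_Tagged.
apply/setP=> -[j e]; rewrite inE; apply/imsetP/imsetP=> [[x xe E]|[x xb E]].
  have ij : i = j := congr1 tag E.
  subst j; exists e => //=; rewrite inE.
  by rewrite (eq_from_Tagged E).
rewrite inE in xb; rewrite E /=.
by exists b.
Qed.

Definition disjoint_union : position :=
  Position union_border_card union_box_degree.

End DisjointUnion.

Definition loops (I : finType) (l : I -> nat) : position :=
  disjoint_union (fun i => loop (l i)).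

Definition loops_cv (n : nat) (l : 'I_n -> nat) : int :=
  if n == 0%N then 0 else 8 + \sum_(i < n) ((l i)%:Z - 8).

(* Main.v *)
Require Import Defs.
From HB Require Import structures.
From mathcomp Require Import all_boot all_order all_algebra.
From mathcomp Require Import zify.

Set Implicit Arguments.
Unset Strict Implicit.
Unset Printing Implicit Defensive.

Import Order.TTheory GRing.Theory Num.Theory.

Local Open Scope ring_scope.

(* While some string of half-taken boxes is on the board, the player to move
   either takes all the loose boxes and moves in the untouched loops, or leaves
   the last four to the opponent, and the move with them.  Opening an untouched
   loop [i] of length [l i] therefore yields the recursion
   [V A = min over i in A of (l i - 4 + |V (A - i) - 4|)] on sets of loops.
   When all lengths are even, [V] agrees with the controlled value modulo 4 and
   is at least the controlled value; opening a shortest loop shows that it is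
   equal to it when this is at least 2, and is at most 4 otherwise.  The residue
   modulo 8 follows from opening a 4-loop, which maps a value [x] to [|x - 4|]. *)

(** * Unclaimed boxes and the boxes claimed by a move *)

Section Covered.

Variable G : position.
Implicit Types (S : {set line G}) (m : line G).

(** Every box has a line, so these are the unclaimed boxes of [S], and a move claims as many boxes
    as this set loses. *)
Definition covered S : {set box G} := [set b | [exists e in S, b \in border e]].

Lemma coveredS S1 S2 : S1 \subset S2 -> covered S1 \subset covered S2.
Proof.
move=> /subsetP S12; apply/subsetP=> b; rewrite !inE => /existsP[e /andP[/S12 eS be]].
by apply/existsP; exists e; rewrite eS.
Qed.

Lemma claimedE S m : m \in S -> claimed S m = covered S :\: covered (S :\ m).
Proof.
move=> mS; apply/setP=> b; rewrite !inE.
have -> : [forall e in S :\ m, b \notin border e] =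
          ~~ [exists e in S :\ m, b \in border e].
  by rewrite negb_exists; apply: eq_forallb => e; rewrite negb_and implybE.
rewrite andbC; case: existsP => //= Nb; apply/idP/existsP => [bm|[e /andP[eS be]]].
  by exists m; rewrite mS.
have [<- //|em] := eqVneq e m.
by case: Nb; exists e; rewrite !inE em eS.
Qed.

Lemma card_claimed S m : m \in S ->
  (#|claimed S m| + #|covered (S :\ m)| = #|covered S|)%N.
Proof.
move=> mS; rewrite claimedE // addnC -[RHS](cardsID (covered (S :\ m))).
by rewrite (setIidPr (coveredS (subD1set S m))).
Qed.

End Covered.

(** * Cyclic order of the lines in a union of loops *)

Section Loops.

Variables (I : finType) (l : I -> nat).
Hypothesis l_ge4 : forall i, (4 <= l i)%N.

Local Notation U := (line (loops l)).
Implicit Types (S X : {set U}) (u m : U) (A : {set I}).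

(** Lines and boxes of a loop have the same index type: line [u] borders the boxes [u] and [next u].
    Elements of [U] are used below in both roles. *)
Definition next u : U := Tagged (fun i => line (loop (l i))) (ordS (tagged u)).

Lemma next_inj : injective next.
Proof.
move=> [i a] [j b] E; have ij : i = j := congr1 tag E.
subst j; have := eq_from_Tagged E; rewrite /= => /(can_inj (@ordSK _)) -> //.
Qed.

Lemma next_surj u : exists2 y, next y = u & tag y = tag u.
Proof.
case: u => i a; exists (Tagged (fun i => line (loop (l i))) (ord_pred (a : 'I_(l i)))) => //.
by rewrite /next /= ord_predK.
Qed.

Definition pos u : nat := (tagged u : 'I_(l (tag u))).

Lemma pos_lt u : (pos u < l (tag u))%N. Proof. exact: ltn_ord. Qed.

Lemma pos_inj u v : tag u = tag v -> pos u = pos v -> u = v.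
Proof. by case: u v => i a [j b] /= ij; subst j => /val_inj /= ->. Qed.

Lemma tag_iter_next k u : tag (iter k next u) = tag u.
Proof. by elim: k. Qed.

Lemma pos_iter_next k u : pos (iter k next u) = ((pos u + k) %% l (tag u))%N.
Proof.
elim: k => [|k IHk]; first by rewrite addn0 modn_small ?pos_lt.
have -> : pos (iter k.+1 next u) = ((pos (iter k next u)).+1 %% l (tag (iter k next u)))%N by [].
by rewrite IHk tag_iter_next -addn1 modnDml addn1 addnS.
Qed.

Lemma iter_next_inj u : {in gtn 4 &, injective (fun k => iter k next u)}.
Proof.
move=> j k j4 k4 /(congr1 pos); rewrite !pos_iter_next => /eqP.
rewrite eqn_modDl !modn_small ?(leq_trans _ (l_ge4 _)) //; first by move/eqP.
Qed.

Lemma nexts_uniq u : uniq [:: u; next u; next (next u); next (next (next u))].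
Proof.
rewrite -[X in uniq X]/[seq iter k next u | k <- iota 0 4].
by rewrite map_inj_in_uniq // => j k; rewrite !mem_iota; apply: iter_next_inj.
Qed.

Lemma nextP u v : tag v = tag u -> exists k, v = iter k next u.
Proof.
(* The walk goes from [u] to position 0 and then on to [v], so no subtraction is truncated. *)
move=> uv; exists (pos v + (l (tag u) - pos u))%N; apply: pos_inj.
  by rewrite tag_iter_next.
rewrite pos_iter_next addnCA subnKC ?(ltnW (pos_lt u)) // modnDr modn_small //.
by rewrite -uv pos_lt.
Qed.

Lemma next_closed X u v : {in X, forall x, tag x = tag u -> next x \in X} ->
  u \in X -> tag v = tag u -> v \in X.
Proof.
move=> XX uX /nextP[k ->]; elim: k => //= k IHk.
by apply: XX; rewrite // tag_iter_next.
Qed.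

Lemma loops_borderE u : border u = [set (u : box (loops l)); (next u : box (loops l))].
Proof.
by case: u => i a; rewrite /border /= /union_border /= /loop_border imsetU1 imset_set1.
Qed.

Lemma mem_coveredP S (b : U) :
  reflect (b \in S \/ exists2 y, y \in S & b = next y) ((b : box (loops l)) \in covered S).
Proof.
rewrite inE; apply: (iffP existsP) => [[e /andP[eS]]|].
  by rewrite loops_borderE !inE => /orP[/eqP->|/eqP->]; [left|right; exists e].
case=> [bS|[y yS ->]]; [exists b | exists y];
  by rewrite ?bS ?yS loops_borderE !inE eqxx ?orbT.
Qed.

Lemma covered_sub S (b : U) : b \in S -> (b : box (loops l)) \in covered S.
Proof. by move=> bS; apply/mem_coveredP; left. Qed.

Lemma covered_next S u : u \in S -> (next u : box (loops l)) \in covered S.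
Proof. by move=> uS; apply/mem_coveredP; right; exists u. Qed.

(** * Untouched loops and loose boxes *)

Definition full S : {set U} :=
  [set u | [forall x : U, (tag x == tag u) ==> (x \in S)]].

Lemma fullP S u : reflect (forall x : U, tag x = tag u -> x \in S) (u \in full S).
Proof.
rewrite inE; apply: (iffP forallP) => [H x xu|H x].
  by have := H x; rewrite xu eqxx.
by apply/implyP => /eqP; apply: H.
Qed.

Lemma full_sub S u : u \in full S -> u \in S.
Proof. by move/fullP; apply. Qed.

Lemma full_tag S u v : tag v = tag u -> (v \in full S) = (u \in full S).
Proof. by move=> vu; apply/fullP/fullP => H x xu; apply: H; rewrite xu. Qed.

Lemma full_next S u : (next u \in full S) = (u \in full S).
Proof. exact: full_tag. Qed.

Lemma fullD1 S m : m \in S -> full (S :\ m) = [set u in full S | tag u != tag m].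
Proof.
move=> mS; apply/setP=> u; rewrite [RHS]inE; apply/fullP/andP.
  move=> H; split; last first.
    by apply/eqP=> um; have := H m (esym um); rewrite !inE eqxx.
  by apply/fullP=> x /H; rewrite inE => /andP[].
case=> /fullP H um x xu; rewrite !inE H // andbT.
by apply: contraNneq um => <-; rewrite xu.
Qed.

Lemma fullD1_notin S m : m \in S -> m \notin full S -> full (S :\ m) = full S.
Proof.
move=> mS mF; rewrite fullD1 //; apply/setP=> u; rewrite inE andb_idr // => uF.
by apply: contraNneq mF => um; rewrite -(full_tag S um).
Qed.

(** Here [full S] is read as the set of boxes of the untouched loops; the loose boxes are those of
    the strings. *)
Definition loose S : {set U} := covered S :\: full S.

Lemma looseE S u : (u \in loose S) = (u \notin full S) && ((u : box (loops l)) \in covered S).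
Proof. by rewrite inE. Qed.

Lemma card_loose S : (#|loose S| + #|full S| = #|covered S|)%N.
Proof.
rewrite addnC -[RHS](cardsID (full S)); congr (_ + _)%N.
rewrite (setIidPr _) //; apply/subsetP=> u /full_sub; exact: covered_sub.
Qed.

Lemma loose_sub S u : u \in S -> u \notin full S -> u \in loose S.
Proof. by move=> uS uF; rewrite looseE uF covered_sub. Qed.

Lemma loose_next S u : u \in S -> u \notin full S -> next u \in loose S.
Proof. by move=> uS uF; rewrite looseE full_next uF covered_next. Qed.

Lemma loose_eq0 S : loose S = set0 -> S = full S.
Proof.
move=> L0; apply/setP=> u; apply/idP/idP=> [uS|]; last exact: full_sub.
by apply/negPn/negP=> uF; have := loose_sub uS uF; rewrite L0 inE.
Qed.

(* [x] is the last line of a string: drawing it claims the box [next x]. *)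
Lemma exit_line S X u : {in X, forall x, x \in S} -> u \in X -> u \notin full S ->
  exists2 x, x \in X & (tag x = tag u) /\ next x \notin X.
Proof.
move=> XS uX uF.
have [/existsP[x /and3P[xX /eqP xu nx]]|/existsPn H] :=
    boolP [exists x, [&& x \in X, tag x == tag u & next x \notin X]].
  by exists x.
(* Without such an [x], the set [X] would be closed under [next] along the loop of [u] and so
   contain the whole loop. *)
case/negP: uF; apply/fullP=> v vu; apply: XS; apply: (next_closed _ uX vu).
by move=> x xX xu; have := H x; rewrite xX xu eqxx /= negbK.
Qed.

Lemma claimed_gt0 S m : m \in S -> next m \notin S -> (0 < #|claimed S m|)%N.
Proof.
move=> mS nS; have := card_claimed mS.
suff: (#|covered (S :\ m)| < #|covered S|)%N by lia.
apply/proper_card/properP; split; first exact: coveredS (subD1set S m).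
exists (next m); first exact: covered_next.
apply/mem_coveredP=> -[|[y]]; rewrite !inE; first by rewrite (negbTE nS) andbF.
by case/andP=> ym _ /next_inj my; rewrite my eqxx in ym.
Qed.

(** A move that claims nothing leaves each of its boxes with its other line, which is the line
    before or after [m]. *)
Lemma claimed_eq0 S m : m \in S -> #|claimed S m| = 0%N ->
  exists2 y, y \in S & [/\ next y = m & next m \in S].
Proof.
move=> mS k0; have covE: covered (S :\ m) = covered S.
  by apply/eqP; rewrite eqEcard -(card_claimed mS) k0 add0n leqnn andbT coveredS ?subD1set.
have := covered_sub mS; rewrite -covE => /mem_coveredP[|[y]]; rewrite in_setD1 ?eqxx //.
case/andP=> _ yS my; exists y => //; split => //.
have := covered_next mS; rewrite -covE => /mem_coveredP[|[z]]; rewrite in_setD1.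
  by case/andP.
by case/andP=> zm _ /next_inj mz; rewrite mz eqxx in zm.
Qed.

Lemma inner_claimed S y : y \in S -> next (next y) \in S ->
  #|claimed S (next y)| = 0%N.
Proof.
move=> yS zS; have := nexts_uniq y.
rewrite /= !inE !negb_or -!andbA => /and5P[y1 _ _ n12 _].
have [mS|mS] := boolP (next y \in S); last first.
  have y'S : next y \notin S :\ next y by rewrite !inE eqxx.
  apply/eqP; rewrite cards_eq0; apply/eqP/setP=> b; rewrite [RHS]inE.
  apply/negP; rewrite inE loops_borderE => /andP[+ /forallP H].
  rewrite in_set2 => /orP[]/eqP bE; subst b.
    by have := H y; rewrite in_setD1 y1 yS loops_borderE in_set2 eqxx orbT.
  have := H (next (next y)).
  by rewrite in_setD1 eq_sym n12 zS loops_borderE in_set2 eqxx.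
suff covE : covered (S :\ next y) = covered S.
  by have := card_claimed mS; rewrite covE -[RHS]add0n => /addIn.
apply/eqP; rewrite eqEsubset coveredS ?subD1set //=; apply/subsetP=> b.
case/mem_coveredP => [bS|[z zS' bz]]; apply/mem_coveredP; rewrite ?in_setD1.
  have [by1|bm] := eqVneq (b : U) (next y); last by left; rewrite bS.
  by right; exists y; rewrite // in_setD1 y1.
have [zy|zy] := eqVneq z (next y); last by right; exists z; rewrite // in_setD1 zy.
by left; rewrite bz zy eq_sym n12.
Qed.

Lemma full_claimed S m : m \in full S -> #|claimed S m| = 0%N.
Proof.
have [y <- _] := next_surj m => /fullP mF.
by apply: inner_claimed; apply: mF.
Qed.

(* Three consecutive lines border a string of at least four boxes. *)
Definition big S :=
  [exists e, [&& e \notin full S, e \in S, next e \in S & next (next e) \in S]].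

Lemma bigP S : reflect
  (exists e, [/\ e \notin full S, e \in S, next e \in S & next (next e) \in S]) (big S).
Proof. by apply: (iffP existsP) => -[e /and4P]; exists e => //; apply/and4P. Qed.

Lemma big_nexts S e : e \notin full S -> e \in S -> next e \in S -> next (next e) \in S ->
  {subset [set e; next e; next (next e); next (next (next e))] <= loose S}.
Proof.
move=> eF e0 e1 e2 u; rewrite 3!in_setU !in_set1 -!orbA => /or4P[]/eqP->.
- exact: loose_sub.
- exact: loose_next.
- by apply: loose_next; rewrite ?full_next.
- by apply: loose_next; rewrite ?full_next.
Qed.

Lemma card_nexts e : #|[set e; next e; next (next e); next (next (next e))]| = 4%N.
Proof.
have := nexts_uniq e => /card_uniqP /= <-; apply: eq_card => u.
by rewrite !inE -!orbA.
Qed.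

Lemma big_loose S : big S -> (4 <= #|loose S|)%N.
Proof.
case/bigP=> e [eF e0 e1 e2]; rewrite -(card_nexts e).
by apply/subset_leq_card/subsetP/big_nexts.
Qed.

(** * How a move changes the untouched loops and the loose boxes *)

Lemma full_idem S : full (full S) = full S.
Proof.
apply/setP=> u; apply/fullP/idP => [|uF v /(full_tag S)->] //.
by apply.
Qed.

Lemma full_fullD1 S m : m \in full S -> full (full S :\ m) = full (S :\ m).
Proof. by move=> mF; rewrite (fullD1 mF) full_idem (fullD1 (full_sub mF)). Qed.

Lemma loose_full S : loose (full S) = set0.
Proof.
apply/eqP; rewrite -cards_eq0; have := card_loose (full S); rewrite full_idem.
suff -> : #|covered (full S)| = #|full S| by lia.
apply: eq_card => b; apply/mem_coveredP/idP=> [[//|[y yF ->]]|]; last by left.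
by rewrite (full_next S).
Qed.

Lemma card_loop_line i : #|[set u : U | tag u == i]| = l i.
Proof.
rewrite -[RHS]card_ord -(card_imset _ (@eq_from_Tagged _ (fun i => 'I_(l i)) i)).
apply: eq_card => -[j a]; rewrite inE; apply/eqP/imsetP => [/= ij|[x _ ->]] //.
by subst j; exists a.
Qed.

Lemma card_loose_open S m : m \in full S ->
  #|loose (S :\ m)| = (#|loose S| + l (tag m))%N.
Proof.
move=> mF; have mS := full_sub mF.
have := card_loose (S :\ m); have := card_loose S; have := card_claimed mS.
rewrite full_claimed // add0n => ->.
have -> : full (S :\ m) = full S :\: [set u : U | tag u == tag m].
  by rewrite fullD1 //; apply/setP=> u; rewrite !inE andbC.
have := cardsID [set u : U | tag u == tag m] (full S).
rewrite (setIidPr _) ?card_loop_line; first by lia.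
by apply/subsetP=> u; rewrite inE => /eqP /(full_tag S) ->.
Qed.

Lemma card_loose_claim S m : m \in S -> m \notin full S ->
  (#|loose (S :\ m)| + #|claimed S m| = #|loose S|)%N.
Proof.
move=> mS mF; have := card_claimed mS.
by rewrite -!card_loose (fullD1_notin mS mF); lia.
Qed.

(** The three lines after [m] remain and differ from [m], because a loop has length at least 4. *)
Lemma big_open S m : m \in full S -> big (S :\ m).
Proof.
move=> mF; have mS := full_sub mF.
have := nexts_uniq m; rewrite /= !inE !negb_or => /andP[/and3P[m1 m2 m3] _].
have inF u : tag u = tag m -> m != u -> u \in S :\ m.
  by move=> um nu; rewrite !inE eq_sym nu (fullP _ _ mF).
apply/bigP; exists (next m).
by split; [rewrite fullD1 // !inE eqxx andbF | exact: inF..].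
Qed.

(** * Moves inside the strings *)

Lemma uniq_leq_card (T : finType) (s : seq T) (A : {set T}) :
  uniq s -> {subset s <= A} -> (size s <= #|A|)%N.
Proof. by move=> /card_uniqP <- sA; apply/subset_leq_card/subsetP. Qed.

Lemma looseD1_exit S m e : m \in S -> m \notin full S -> e \notin full S ->
  m \notin [:: e; next e; next (next e)] ->
  e \in S -> next e \in S -> next (next e) \in S -> big (S :\ m).
Proof.
move=> mS mF eF; rewrite !inE !negb_or => /and3P[m0 m1 m2] e0 e1 e2.
apply/bigP; exists e; rewrite fullD1_notin // !in_setD1 e0 e1 e2.
by rewrite eq_sym m0 eq_sym m1 eq_sym m2.
Qed.

(** Drawing the middle line of a string of four boxes offers them to the opponent as two pairs; this
    is how the move is passed on. *)
Lemma big_split S : big S -> #|loose S| = 4%N ->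
  exists2 m, m \in S & [/\ m \notin full S, #|claimed S m| = 0%N & ~~ big (S :\ m)].
Proof.
case/bigP=> e [eF e0 e1 e2] T4; exists (next e) => //; split.
- by rewrite full_next.
- exact: inner_claimed.
apply/bigP=> -[d []]; rewrite fullD1_notin ?full_next // !in_setD1.
move=> dF /andP[d0 dS0] /andP[d1 dS1] /andP[d2 dS2].
have [x xS [xe nx]] := exit_line (fun _ xS => xS) e0 eF.
have xF : x \notin full S by rewrite (full_tag S xe).
(* The box beyond the exit line [x] is loose, but its namesake line is drawn. So at most three lines
   lie outside the untouched loops, too few for [next e] and a second triple. *)
have : (#|S :\: full S| < #|loose S|)%N.
  apply/proper_card/properP; split.
    by apply/subsetP=> u; rewrite in_setD => /andP[uF uS]; apply: loose_sub.
  by exists (next x); rewrite ?loose_next // in_setD (negbTE nx) andbF.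
apply/negP; rewrite T4 -leqNgt; apply: (@uniq_leq_card _ [:: next e; d; next d; next (next d)]).
  rewrite cons_uniq !inE !negb_or eq_sym d0 eq_sym d1 eq_sym d2 /=.
  by have := nexts_uniq d; rewrite /= !inE !negb_or -!andbA => /and5P[-> -> _ -> _].
by move=> u; rewrite in_setD 3!inE mem_seq1 => /or4P[]/eqP->;
  rewrite ?(full_next, dS0, dS1, dS2, e1) ?andbT.
Qed.

(** A box is taken at the end of a string while three consecutive lines survive: at an exit line
    outside the triple at [e] if one is found, otherwise at the end of that triple, which is then
    shifted back by one line. *)
Lemma big_capture S : big S -> (4 < #|loose S|)%N ->
  exists2 m, m \in S & [/\ m \notin full S, (0 < #|claimed S m|)%N & big (S :\ m)].
Proof.
case/bigP=> e [eF e0 e1 e2] T4.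
have [x xS [xe nx]] := exit_line (fun _ xS => xS) e0 eF.
have xF : x \notin full S by rewrite (full_tag S xe).
have [xB|xB] := boolP (x \in [:: e; next e; next (next e)]); last first.
  by exists x => //; split; rewrite ?claimed_gt0 ?(looseD1_exit _ _ eF).
have {xB} xE : x = next (next e).
  by move: xB; rewrite !inE => /or3P[]/eqP xB //; rewrite xB ?e1 ?e2 in nx.
pose C := (S :\: full S) :\: [set e; next e; next (next e)].
have CS y : y \in C -> y \in S by rewrite in_setD => /andP[_ /setDP[]].
have CF y : y \in C -> y \notin full S by rewrite in_setD => /andP[_ /setDP[]].
(* The triple alone would account for only four loose boxes. *)
have [y yC] : exists y, y \in C.
  apply/set0Pn; apply: contraTneq T4 => C0; rewrite -leqNgt -(card_nexts e).
  apply/subset_leq_card/subsetP => u.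
  have SB v : v \in S -> v \notin full S -> v \in [set e; next e; next (next e)].
    by move=> vS vF; have := in_set0 v; rewrite -C0 !in_setD vS vF !andbT => /negbFE.
  rewrite looseE => /andP[uF /mem_coveredP[/SB/(_ uF)|[v vS uv]]].
    by move=> uB; rewrite in_setU uB.
  have := SB v vS; rewrite -(full_next S) -uv => /(_ uF).
  rewrite uv !inE -!orbA => /or3P[]/eqP->; by rewrite eqxx ?orbT.
have [z zC [_ nz]] := exit_line CS yC (CF _ yC).
have [zS|zS] := boolP (next z \in S); last first.
  exists z; first exact: CS.
  split; [exact: CF | exact: claimed_gt0 (CS _ zC) zS |].
  apply: (looseD1_exit (CS _ zC) (CF _ zC) eF) => //.
  by move: zC; rewrite in_setD !inE -!orbA => /andP[].
have zF : next z \notin full S by rewrite full_next CF.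
move: (zC); rewrite in_setD => /andP[zB _].
(* The line [next z] is undrawn but outside [C], so it lies in the triple; as [z] does not, it can
   only be [e], and [z] starts the shifted triple. *)
have ze : next z = e.
  move: nz zB; rewrite in_setD in_setD zF zS !andbT negbK !inE.
  by case/orP=> [/orP[/eqP // | /eqP/next_inj->]|/eqP/next_inj->]; rewrite eqxx ?orbT.
exists (next (next e)) => //; rewrite -xE; split=> //; first exact: claimed_gt0.
apply: (looseD1_exit xS xF (CF _ zC)); rewrite ?ze // ?(CS _ zC) // xE.
have := nexts_uniq e; rewrite /= !inE !negb_or -!andbA => /and5P[_ n2 _ n12 _].
rewrite ![next (next e) == _]eq_sym n2 n12 !andbT.
by move: zB; rewrite !inE !negb_or => /andP[_].
Qed.

(* The two terms of the minimum are the values of taking all the [T] loose boxes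
   and of leaving four of them; the latter needs a string of at least four. *)
Definition string_value S : int :=
  let V := value_at (full S) in let T : int := #|loose S|%:Z in
  if big S then Num.min (V - T) (8 - T - V) else V - T.

(** After the opening the loose boxes are those of this loop, so the claim reduces to
    [max (- V) (V - 8) = |V - 4| - 4]. *)
Lemma string_value_open S m : full S = S -> m \in S ->
  - string_value (S :\ m) = (l (tag m))%:Z - 4 + `|value_at (full (S :\ m)) - 4|.
Proof.
move=> SF mS; have mF : m \in full S by rewrite SF.
have L0 : #|loose S| = 0%N by rewrite -SF loose_full cards0.
by rewrite /string_value big_open // card_loose_open // L0; lia.
Qed.

(** Induction on the number of undrawn lines. A check of all moves shows that none goes below
    [string_value]. Capturing at an exit line gives [V - T]; given a triple, capturing down to four
    boxes and then splitting gives [8 - T - V]. *)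
Lemma value_atE S : value_at S = string_value S.
Proof.
elim: {S}_.+1 {-2}S (ltnSn #|S|) => // d IH S /ltnSE cS.
(* Stated for subsets [X] because it serves moves in [full S] as well as in [S]. *)
have IHD X m : m \in X -> X \subset S -> value_at (X :\ m) = string_value (X :\ m).
  move=> mX /subset_leq_card XS; apply: IH.
  by move: XS cS; rewrite (cardsD1 m X) mX; lia.
rewrite /string_value; set V := value_at (full S); set T : int := #|loose S|%:Z => /=.
have [L0|] := eqVneq (loose S) set0.
  rewrite /V -(loose_eq0 L0) /T L0 cards0.
  have /negPf -> : ~~ big S by apply/negP => /big_loose; rewrite L0 cards0.
  by rewrite subr0.
rewrite -card_gt0 => T0.
have open_le m : m \in full S ->
    V <= (l (tag m))%:Z - 4 + `|value_at (full (S :\ m)) - 4|.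
  move=> mF; apply: le_trans (value_at_le mF) _.
  have FS : full S \subset S by apply/subsetP => u; apply: full_sub.
  rewrite /move_value (@full_claimed (full S)) ?full_idem // eqxx (IHD _ _ mF FS).
  by rewrite string_value_open ?full_idem // full_fullD1.
have lower m : m \in S ->
    (if big S then Num.min (V - T) (8 - T - V) else V - T) <= move_value (@value_at _) S m.
  move=> mS; rewrite /move_value IHD // /string_value.
  have [mF|mF] := boolP (m \in full S).
    (* By [open_le], opening a loop while [T] boxes are loose has value at least [V + T]. *)
    have := open_le m mF; rewrite full_claimed // eqxx big_open // card_loose_open //.
    by rewrite /T; case: (big S); lia.
  rewrite fullD1_notin // -/V; have := card_loose_claim mS mF; rewrite /T.
  have [k0|k0] := eqVneq #|claimed S m| 0%N.
    (* Such a move has value at least [T - V]; the triple around [m] gives [T >= 4], hence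
       [T - V >= 8 - T - V]. *)
    have [y yS [ym nm]] := claimed_eq0 mS k0.
    have bS : big S by apply/bigP; exists y; rewrite ym -(full_next S) ym.
    by have := big_loose bS; rewrite bS k0; case: (big _); lia.
  have : big (S :\ m) -> big S.
    case/bigP=> e []; rewrite fullD1_notin // !in_setD1 => eF.
    case/andP=> _ e0 /andP[_ e1] /andP[_ e2].
    by apply/bigP; exists e.
  by case: (big (S :\ m)); case: (big S) => H; try lia; case: (H isT).
have capture m : m \in S -> m \notin full S -> (0 < #|claimed S m|)%N ->
    value_at S <= if big (S :\ m) then Num.min (V - T) (8 - T - V) else V - T.
  move=> mS mF k0; apply: le_trans (value_at_le mS) _.
  rewrite /move_value gtn_eqF // IHD // /string_value fullD1_notin // -/V.
  by have := card_loose_claim mS mF; rewrite /T; case: (big _); lia.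
apply/le_anti/andP; split; last first.
  have S0 : S != set0.
    apply: contraTneq T0 => ->; rewrite -leqNgt leqn0 cards_eq0 -subset0.
    by apply/subsetP=> b; rewrite looseE => /andP[_ /mem_coveredP[|[y]]]; rewrite inE.
  by have [m mS ->] := value_at_attained S0; apply: lower.
have [b bL] := card_gt0P T0.
have [u uS uF] : exists2 u, u \in S & u \notin full S.
  move: bL; rewrite looseE => /andP[bF /mem_coveredP[bS|[y yS bE]]].
    by exists b.
  by exists y; rewrite // -(full_next S) -bE.
have [x xS [xu nx]] := exit_line (fun _ xS => xS) uS uF.
have xF : x \notin full S by rewrite (full_tag S xu).
have VT : value_at S <= V - T.
  apply: le_trans (capture x xS xF (claimed_gt0 xS nx)) _.
  by case: (big _); rewrite ?ge_min lexx.
case: ifP => // bS; have [T4|T4] := leqP #|loose S| 4.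
  have {}T4 : #|loose S| = 4%N by apply/eqP; rewrite eqn_leq T4 big_loose.
  have [m mS [mF k0 nb]] := big_split bS T4.
  rewrite le_min VT; apply: le_trans (value_at_le mS) _.
  rewrite /move_value k0 eqxx IHD // /string_value fullD1_notin // -/V (negbTE nb).
  by have := card_loose_claim mS mF; rewrite k0 /T; lia.
have [m mS [mF k0 b']] := big_capture bS T4.
by have := capture m mS mF k0; rewrite b'.
Qed.

(** * Positions made of whole loops, and their recursion *)

Definition loop_lines A : {set U} := [set u | tag u \in A].

Lemma full_loop_lines A : full (loop_lines A) = loop_lines A.
Proof.
apply/setP=> u; apply/fullP/idP => [|uA v vu]; first by apply.
by rewrite inE vu; rewrite inE in uA.
Qed.

Lemma full_loop_linesD1 A m : m \in loop_lines A -> full (loop_lines A :\ m) = loop_lines (A :\ tag m).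
Proof.
by move=> mA; rewrite fullD1 // full_loop_lines; apply/setP=> u; rewrite !inE andbC.
Qed.

Lemma move_loop_lines A m : m \in loop_lines A -> move_value (@value_at _) (loop_lines A) m =
  (l (tag m))%:Z - 4 + `|value_at (loop_lines (A :\ tag m)) - 4|.
Proof.
move=> mA; rewrite /move_value full_claimed ?full_loop_lines // eqxx value_atE.
by rewrite string_value_open ?full_loop_lines // full_loop_linesD1.
Qed.

End Loops.

(** The recursion as a property of [V], which frees the arithmetic below from positions. A bound and
    its attainment stand for the minimum over [A]. *)
Definition loop_recursion (I : finType) (l : I -> nat) (V : {set I} -> int) :=
  [/\ V set0 = 0,
      forall (A : {set I}) i, i \in A -> V A <= (l i)%:Z - 4 + `|V (A :\ i) - 4|
    & forall A : {set I}, A != set0 ->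
        exists2 i, i \in A & V A = (l i)%:Z - 4 + `|V (A :\ i) - 4|].

Lemma value_loop_lines_recursion (I : finType) (l : I -> nat) :
  (forall i, (4 <= l i)%N) -> loop_recursion l (fun A => value_at (loop_lines l A)).
Proof.
move=> l4; split=> [|A i iA|A An0].
- have -> : loop_lines l set0 = set0 by apply/setP=> u; rewrite !inE.
  by rewrite value_at0.
- have li : (0 < l i)%N by apply: leq_trans (l4 i).
  pose m : line (loops l) := Tagged (fun i => 'I_(l i)) (Ordinal li).
  have mA : m \in loop_lines l A by rewrite inE.
  by apply: le_trans (value_at_le mA) _; rewrite move_loop_lines.
have [i iA] := set0Pn _ An0.
have li : (0 < l i)%N by apply: leq_trans (l4 i).
have Rn0 : loop_lines l A != set0.
  by apply/set0Pn; exists (Tagged (fun i => 'I_(l i)) (Ordinal li)); rewrite inE.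
have [m mA ->] := value_at_attained Rn0.
by exists (tag m); [rewrite inE in mA | rewrite move_loop_lines].
Qed.

Lemma value_loops (I : finType) (l : I -> nat) :
  value (loops l) = value_at (loop_lines l [set: I]).
Proof. by congr value_at; apply/setP=> u; rewrite !inE. Qed.

(** The recursion determines its solution. This identifies the values of a subfamily of loops,
    indexed by its own type, with values of [V] at subsets of [I]. *)
Lemma loop_recursion_inj (I J : finType) (h : J -> I) (l : I -> nat) V W :
  injective h -> loop_recursion l V -> loop_recursion (l \o h) W ->
  forall B, W B = V (h @: B).
Proof.
move=> hI [V0 Vle Vatt] [W0 Wle Watt] B.
elim: {B}_.+1 {-2}B (ltnSn #|B|) => // d IH B /ltnSE cB.
have imD1 j : h @: (B :\ j) = h @: B :\ h j.
  apply/setP=> x; apply/imsetP/setD1P=> [[y /setD1P[yj yB] ->]|[xj /imsetP[y yB xy]]].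
    by rewrite inj_eq // imset_f.
  by exists y; rewrite // !inE yB andbT; apply: contraNneq xj => <-; rewrite xy.
have {}IH j : j \in B -> W (B :\ j) = V (h @: B :\ h j).
  by move=> jB; rewrite -imD1; apply: IH; move: cB; rewrite (cardsD1 j B) jB; lia.
have [->|Bn0] := eqVneq B set0; first by rewrite imset0 V0 W0.
apply/le_anti/andP; split.
  have [|_ /imsetP[j jB ->] ->] := Vatt (h @: B).
    by have [j jB] := set0Pn _ Bn0; apply/set0Pn; exists (h j); apply: imset_f.
  by rewrite -IH //; apply: Wle.
have [j jB ->] := Watt B Bn0.
by rewrite IH //; apply/Vle/imset_f.
Qed.

(** * Controlled value of a set of loops *)

Section ControlledValue.

Variables (I : finType) (l : I -> nat).
Implicit Type A : {set I}.

Lemma setD1_ind (P : {set I} -> Prop) :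
  (forall A, (forall i, i \in A -> P (A :\ i)) -> P A) -> forall A, P A.
Proof.
move=> H A; elim: {A}_.+1 {-2}A (ltnSn #|A|) => // d IH A /ltnSE cA.
by apply: H => i iA; apply: IH; move: cA; rewrite (cardsD1 i A) iA; lia.
Qed.

(* On [set0] this is [8] and not the [0] of [loops_cv]: both are at distance
   [4] from [4], so the recursion does not tell them apart. *)
Definition cv A : int := 8 + \sum_(i in A) ((l i)%:Z - 8).

Lemma cv0 : cv set0 = 8. Proof. by rewrite /cv big_set0 addr0. Qed.

Lemma cvD1 A i : i \in A -> cv A = cv (A :\ i) + (l i)%:Z - 8.
Proof. by move=> iA; rewrite /cv (big_setD1 i) //=; move: (\sum_(j in A :\ i) _) => s; lia. Qed.

Lemma cv_ge8 A : {in A, forall i, (8 <= l i)%N} -> 8 <= cv A.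
Proof. by move=> A8; rewrite /cv lerDl sumr_ge0 // => i /A8; lia. Qed.

Lemma cv_le0_n0 A : cv A <= 0 -> A != set0.
Proof. by apply: contraTneq => ->; rewrite cv0. Qed.

Local Notation fours := [set i | l i == 4%N].

Lemma cv_fours A : cv A = cv (A :\: fours) - 4 * #|A :&: fours|%:Z.
Proof.
rewrite /cv (big_setID fours) /= (eq_bigr (fun=> -4)).
  by rewrite sumr_const -mulr_natr natz; move: (\sum_(i in A :\: fours) _) => s; lia.
by move=> i; rewrite !inE => /andP[_ /eqP->].
Qed.

Lemma foursD1 A i : i \in A -> l i = 4%N ->
  (A :\ i) :\: fours = A :\: fours /\ #|A :&: fours| = #|(A :\ i) :&: fours|.+1.
Proof.
move=> iA li; split.
  by apply/setP=> j; rewrite !inE; have [->|//] := eqVneq j i; rewrite li.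
rewrite (cardsD1 i) !inE iA li eqxx add1n; congr (#|pred_of_set _|.+1).
by apply/setP=> j; rewrite !inE andbA.
Qed.

End ControlledValue.

(** * Arithmetic of the recursion for even lengths *)

Section Recursion.

Variables (I : finType) (l : I -> nat) (V : {set I} -> int).
Hypothesis l_ge4 : forall i, (4 <= l i)%N.
Hypothesis l_even : forall i, ~~ odd (l i).
Hypothesis recV : loop_recursion l V.
Implicit Type A : {set I}.

Local Notation cv := (cv l).
Local Notation fours := [set i | l i == 4%N].

Let V0 : V set0 = 0. Proof. by case: recV. Qed.
Let V_le A i : i \in A -> V A <= (l i)%:Z - 4 + `|V (A :\ i) - 4|.
Proof. by case: recV => _ H _; apply: H. Qed.
Let V_att A : A != set0 ->
  exists2 i, i \in A & V A = (l i)%:Z - 4 + `|V (A :\ i) - 4|.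
Proof. by case: recV => _ _; apply. Qed.

Lemma V_ge0 A : 0 <= V A.
Proof.
have [->|/V_att[i iA ->]] := eqVneq A set0; first by rewrite V0.
by have := l_ge4 i; lia.
Qed.

(** Follows from [|x - 4| >= x - 4]; for a single loop both sides are its length. *)
Lemma V_ge_cv A : A != set0 -> cv A <= V A.
Proof.
elim/setD1_ind: A => A IH /V_att[i iA ->]; rewrite (cvD1 l iA).
have [->|A'0] := eqVneq (A :\ i) set0; first by rewrite cv0 V0; lia.
by have := IH i iA A'0; lia.
Qed.

(** For even [x], [|x - 4|] and [x] agree modulo 4. *)
Lemma V_mod4 A : (V A %% 2 = 0)%Z /\ (V A = cv A %[mod 4])%Z.
Proof.
elim/setD1_ind: A => A IH.
have [->|/V_att[i iA ->]] := eqVneq A set0; first by rewrite V0 cv0.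
rewrite (cvD1 l iA); have [] := IH i iA; have := l_even i.
by move: (V _) (cv _) => x y; lia.
Qed.

Lemma V_eq_cv A : A != set0 -> 2 <= cv A -> V A = cv A.
Proof.
elim/setD1_ind: A => A IH An0 c2; apply/le_anti/andP; split; last exact: V_ge_cv.
(* The bound 4 removes the absolute value. A loop shorter than 8 has length at most 6 by parity, so
   its removal raises [cv] by at least 2; if there is none, what remains has [cv] at least 8. *)
have [i iA ci] : exists2 i, i \in A & 4 <= cv (A :\ i).
  have [/existsP[i /andP[iA li]]|/existsPn H] := boolP [exists i in A, (l i < 8)%N].
    by exists i => //; move: c2; rewrite (cvD1 l iA); have := l_even i; lia.
  have [i iA] := set0Pn _ An0; exists i => //.
  apply: (le_trans _ (cv_ge8 _)) => // j; rewrite in_setD1 => /andP[_ jA].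
  by have := H j; rewrite jA -leqNgt.
apply: le_trans (V_le iA) _; rewrite (cvD1 l iA).
have [->|A'0] := eqVneq (A :\ i) set0; first by rewrite V0 cv0; lia.
by rewrite IH //; lia.
Qed.

Lemma V_ge2 A : {in A, forall i, l i != 4%N} -> A != set0 -> 2 <= V A.
Proof. by move=> A4 /V_att[i iA ->]; have := A4 i iA; have := l_ge4 i; have := l_even i; lia. Qed.

(** As [cv A <= 0], some loop is shorter than 8, and the rest after its removal has value at most 4.
    Opening a 4-loop suffices; if there is none, opening a 6-loop does, since the rest then has
    value at least 2. *)
Lemma V_le4 A : cv A <= 0 -> V A <= 4.
Proof.
elim/setD1_ind: A => A IH c0.
have V'_le4 i : i \in A -> (l i < 8)%N -> A :\ i != set0 /\ V (A :\ i) <= 4.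
  move=> iA li; have := cvD1 l iA; have := l_ge4 i => l4 cA.
  have A'0 : A :\ i != set0 by apply: contra_eqT cA => /negPn/eqP->; rewrite cv0; lia.
  split=> //; have [c2|c2] := leP 2 (cv (A :\ i)); first by rewrite V_eq_cv //; lia.
  (* Being congruent modulo 4 to an even value, [cv (A :\ i)] is even; below 2 it is at most 0. *)
  have [_ V4] := V_mod4 (A :\ i).
  have [_] := V_mod4 A; have [] := V_mod4 (A :\ i); have [c0'|] := leP (cv (A :\ i)) 0; last by lia.
  by move=> *; apply: IH.
have [/existsP[i /andP[iA li]]|/existsPn A4] := boolP [exists i in A, l i == 4%N].
  have [_ V'4] : A :\ i != set0 /\ V (A :\ i) <= 4 by apply: V'_le4; rewrite // (eqP li).
  by have := V_le iA; have := V_ge0 (A :\ i); rewrite (eqP li); lia.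
have [/existsP[i /andP[iA li]]|/existsPn H] := boolP [exists i in A, (l i < 8)%N].
  have [A'0 V'4] := V'_le4 i iA li.
  have : 2 <= V (A :\ i).
    apply: V_ge2 A'0 => j; rewrite in_setD1 => /andP[_ jA].
    by have := A4 j; rewrite jA.
  by have := V_le iA; have := l_even i; lia.
have : 8 <= cv A by apply: cv_ge8 => j jA; have := H j; rewrite jA -leqNgt.
by lia.
Qed.

(** If [0 <= x <= 4] and 4 divides [x], then [|x - 4|] is congruent to [x + 4] modulo 8, so each
    4-loop contributes 4. *)
Lemma V_mod8 A : cv A <= 0 -> (cv A %% 4 = 0)%Z -> A :&: fours != set0 ->
  (V A = V (A :\: fours) + 4 * #|A :&: fours|%:Z %[mod 8])%Z.
Proof.
elim/setD1_ind: A => A IH c0 c4 /set0Pn[i0]; rewrite !inE => /andP[i0A /eqP li0].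
have cV := V_mod4 A; have Vge := V_ge0 A; have Vle := V_le4 c0.
have four i : i \in A -> l i = 4%N -> 0 <= V (A :\ i) <= 4 /\
    (V (A :\ i) + 4 = V (A :\: fours) + 4 * #|A :&: fours|%:Z %[mod 8])%Z.
  move=> iA li; have [KE fE] := foursD1 iA li.
  have := cvD1 l iA; rewrite li => cE.
  have A'0 : A :\ i != set0 by apply: contra_eqT cE => /negPn/eqP->; rewrite cv0; lia.
  have [c2|c2] := leP 2 (cv (A :\ i)).
    (* Here [cv (A :\ i) = 4] and [cv A = 0], so [cv (A :\: fours)] is four times the number of
       4-loops in [A]. *)
    have VE := V_eq_cv A'0 c2; have cK := cv_fours l A.
    split; first lia.
    have [K0|K0] := eqVneq (A :\: fours) set0; first by move: cK; rewrite K0 V0 cv0; lia.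
    by rewrite (V_eq_cv K0); lia.
  have c'0 : cv (A :\ i) <= 0 by lia.
  split; first by rewrite V_ge0 V_le4.
  have [f0|f0] := eqVneq ((A :\ i) :&: fours) set0.
    have KA : (A :\ i) :\: fours = A :\ i by apply/setDidPl; rewrite -setI_eq0 f0.
    by rewrite fE f0 cards0 -KE KA; lia.
  have := IH i iA c'0 _ f0; rewrite KE fE.
  by lia.
have [j jA Vj] := V_att (cv_le0_n0 c0).
have [lj|lj] := eqVneq (l j) 4%N.
  by have [] := four j jA lj; rewrite Vj lj; have := V_mod4 (A :\ j); have := cvD1 l jA; lia.
(* An optimal opening of a longer loop has positive value, hence at least 4 by divisibility; the
   bound from [i0] then forces [V (A :\ i0) = 0]. *)
have V4 : 4 <= V A.
  have := V_mod4 (A :\ j); have := cvD1 l jA; have := l_even j; have := l_ge4 j.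
  by rewrite Vj; lia.
have := V_le i0A; have [] := four i0 i0A li0; have := V_mod4 (A :\ i0); have := cvD1 l i0A.
by rewrite li0; lia.
Qed.

Lemma V_no_fours A : cv A <= 0 -> A :&: fours = set0 -> V A = 2 \/ V A = 4.
Proof.
move=> c0 f0; have [V2 _] := V_mod4 A; have := V_le4 c0.
suff : 2 <= V A by lia.
apply: V_ge2 (cv_le0_n0 c0) => i iA; apply/negP => li.
by have := in_set0 i; rewrite -f0 !inE iA li.
Qed.

(** Removing 4-loops changes [cv] by a multiple of 4, so [V A] and [V (A :\: fours)] agree modulo 4,
    while [0 <= V A <= 4]. *)
Lemma V_fours A : cv A <= 0 -> A :&: fours != set0 ->
  ((V (A :\: fours) = 2 %[mod 4])%Z -> V A = 2) /\
  (~ (V (A :\: fours) = 2 %[mod 4])%Z ->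
    (V A = 0 \/ V A = 4) /\
    (V A = V (A :\: fours) + 4 * #|A :&: fours|%:Z %[mod 8])%Z).
Proof.
move=> c0 f0; have Vle := V_le4 c0; have Vge := V_ge0 A; have cf := cv_fours l A.
have [V2 V4] := V_mod4 A; have [K2 K4] := V_mod4 (A :\: fours).
split=> nK; first by lia.
have c4 : (cv A %% 4 = 0)%Z by lia.
by split; [lia | apply: V_mod8].
Qed.

End Recursion.

(** * Translation of the recursion results to values of games *)

Theorem theorem12 (n : nat) (l : 'I_n -> nat)
    (l_ge4 : forall i, (4 <= l i)%N) (l_even : forall i, ~~ odd (l i)) :
  let G := loops l in
  let c := loops_cv l in
  let f := #|[set i | l i == 4%N]| in
  let K := loops (fun i : {i : 'I_n | l i != 4%N} => l (val i)) in
  [/\ (* (a) *)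
      (forall i, (8 <= l i)%N) -> value G = c,
      (* (b) *)
      2 <= c \/ n = 0%N -> value G = c,
      (* (c) *)
      c <= 0 -> f = 0%N -> (0 < n)%N ->
        (value G = 2 \/ value G = 4) /\ (value G = c %[mod 4])%Z
    & (* (d) *)
      c <= 0 -> (1 <= f)%N ->
        ((value K = 2 %[mod 4])%Z -> value G = 2) /\
        (~ (value K = 2 %[mod 4])%Z ->
          (value G = 0 \/ value G = 4) /\
          (value G = value K + 4 * f%:Z %[mod 8])%Z)].
Proof.
move=> G c f K.
pose V (A : {set 'I_n}) := value_at (loop_lines l A).
have recV : loop_recursion l V := value_loop_lines_recursion l_ge4.
have GE : value G = V setT by rewrite /G value_loops.
pose fours := [set i | l i == 4%N].
have KE : value K = V (setT :\: fours).
  have recK := @value_loop_lines_recursion _ (fun i : {i : 'I_n | l i != 4%N} => l (val i))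
    (fun i => l_ge4 (val i)).
  rewrite /K value_loops (loop_recursion_inj val_inj recV recK setT); congr V.
  apply/setP=> i; rewrite !inE andbT; apply/imsetP/idP => [[x _ ->]|i4].
    exact: (valP x).
  by exists (exist _ i i4).
clearbody V; have fE : f = #|setT :&: fours| by rewrite setTI.
have cE : (0 < n)%N -> c = cv l setT.
  rewrite /c /loops_cv lt0n => /negPf ->.
  by rewrite /cv; congr (8 + _); apply: eq_bigl => i; rewrite inE.
have Tn0 : (0 < n)%N -> [set: 'I_n] != set0.
  by move=> n0; rewrite -card_gt0 cardsT card_ord.
have c_ge2 : 2 <= c \/ n = 0%N -> value G = c.
  (* For [n = 0], [c] is 0 but [cv] is 8, so this case is read off [V set0 = 0]. *)
  rewrite GE; have [n0 _|n0 [c2|n0']] := posnP n; last by rewrite n0' in n0.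
    have -> : [set: 'I_n] = set0.
      by apply/eqP; rewrite -cards_eq0 cardsT card_ord n0.
    by rewrite /c /loops_cv (introT eqP n0); case: recV.
  by rewrite cE // (V_eq_cv l_even recV) ?Tn0 // -cE.
split=> //.
- move=> l8; apply: c_ge2; have [->|n0] := posnP n; first by right.
  left; rewrite cE //; have : 8 <= cv l setT by apply: cv_ge8 => i _; apply: l8.
  exact: le_trans.
- move=> c0 f0 n0; rewrite GE cE // in c0 *.
  have [_ V4] := V_mod4 l_even recV setT; split; last exact: V4.
  apply: (V_no_fours l_ge4 l_even recV c0).
  by apply/eqP; rewrite -cards_eq0 -fE f0.
move=> c0 f1; have n0 : (0 < n)%N.
  by have [i _] := card_gt0P f1; apply: leq_ltn_trans (ltn_ord i).
rewrite GE KE fE; rewrite cE // in c0.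
by apply: (V_fours l_ge4 l_even recV c0); rewrite -card_gt0 -fE.
Qed.
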